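(* Let $\omega$ be a $(p,p)$ double form on an $n$-dimensional Riemannian manifold and let $k$ be an integer with $0\leq pk\leq n-p$. Then $$\langle N_{pk}(\omega),\omega\rangle=\frac{c^{pk+p}\,\omega^{k+1}}{(pk+p)!},\qquad\text{where}\quad N_{pk}(\omega)=*\frac{g^{n-pk-p}\omega^k}{(n-pk-p)!}.$$ In particular, if $R$ denotes the Riemann curvature tensor, the Gauss–Bonnet curvatures are determined by $h_{2k+2}=\langle N_{2k}(R),R\rangle$ (for $0\le 2k\le n-2$).
   Context: A $(p,q)$ double form on $(M,g)$ is a section of $\Lambda^pT^*M\otimes\Lambda^qT^*M$. Juxtaposition and powers denote the exterior (Kulkarni–Nomizu) product $(\omega_1\otimes\omega_2)(\theta_1\otimes\theta_2)=(\omega_1\wedge\theta_1)\otimes(\omega_2\wedge\theta_2)$; thus $g^k(x_1,\dots,x_k;y_1,\dots,y_k)=k!\det[g(x_i,y_j)]$. The contraction is $c\,\omega(x_2,\dots;y_2,\dots)=\sum_i\omega(e_i,x_2,\dots;e_i,y_2,\dots)$ for an orthonormal basis $(e_i)$, $c^r$ its $r$-th iterate. $*(\omega_1\otimes\omega_2)=( *\omega_1)\otimes( *\omega_2)$ is the Hodge operator. $\langle\cdot,\cdot\rangle$ is the inner product for which the $e_I^*\otimes e_J^*$ ($I,J$ increasing multi-indices) are orthonormal. $N_{pk}(\omega)$, a $(p,p)$ double form, is the $k$-th Newton transformation of $\omega$. The Riemann tensor $R$ is regarded as a $(2,2)$ double form with $R(x,y;x,y)$ the sectional curvature for orthonormal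 $x,y$, and the $(2k)$-th Gauss–Bonnet curvature is $h_{2k}=\frac{1}{(n-2k)!}*(g^{n-2k}R^k)=\frac{c^{2k}R^k}{(2k)!}$ for $0\le 2k\le n$. *)

(* Defs.v *)
From HB Require Import structures.
From mathcomp Require Import all_boot all_order all_algebra.
From mathcomp Require Import all_classical all_reals all_analysis.

Set Implicit Arguments.
Unset Strict Implicit.
Unset Printing Implicit Defensive.

Import Order.TTheory GRing.Theory Num.Theory.
Import numFieldNormedType.Exports.

Local Open Scope classical_set_scope.
Local Open Scope ring_scope.

(* Double forms on one tangent space E.

   An element of the algebra of double forms (the direct sum of all
   Lambda^p E^* (x) Lambda^q E^* ) is encoded by its values
   omega(x_1,...,x_a; y_1,...,y_b) on two sequences of vectors of arbitrary
   lengths a and b: its component of bidegree (p, q) is its restriction to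
   sequences of lengths p and q, and Lambda^p E^* (x) Lambda^q E^* is identified
   with the functions that are p-linear alternating in x and q-linear alternating
   in y. *)
Section DoubleForms.
Variables (R : realType) (E : vectType R).

Definition pre_dform := seq E -> seq E -> R.

Definition alternating_form (p : nat) (f : seq E -> R) : Prop :=
  [/\ forall s, size s != p -> f s = 0,
      forall s t a u v,
        f (s ++ (a *: u + v) :: t) = a * f (s ++ u :: t) + f (s ++ v :: t)
    & forall s, ~~ uniq s -> f s = 0].

Definition is_dform (p q : nat) (w : pre_dform) : Prop :=
  (forall y, alternating_form p (w^~ y)) /\ (forall x, alternating_form q (w x)).

(* A mask m of length a splits x_1,...,x_a into the subsequence selected by m
   followed by the remaining one; this is the parity of that (inverse) shuffle. *)
Definition shuffle_inversions (m : bitseq) : nat :=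
  \sum_(i < size m) \sum_(j < i) (nth false m i && ~~ nth false m j).

(* The bilinear extension of
   (w1 (x) w2) (t1 (x) t2) = (w1 /\ t1) (x) (w2 /\ t2), with the wedge product of
   alternating forms evaluated by the shuffle formula, so that the product of
   covectors satisfies (a_1 /\ ... /\ a_p)(x_1,...,x_p) = det [a_i(x_j)]. *)
Definition dform_mul (w t : pre_dform) : pre_dform := fun x y =>
  \sum_(m : (size x).-tuple bool) \sum_(l : (size y).-tuple bool)
    (-1) ^+ (shuffle_inversions m + shuffle_inversions l)
    * w (mask m x) (mask l y)
    * t (mask (map negb m) x) (mask (map negb l) y).

Definition dform_one : pre_dform := fun x y => (nilp x && nilp y)%:R.

Definition dform_exp (w : pre_dform) (k : nat) : pre_dform :=
  iter k (dform_mul w) dform_one.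

Definition dform_scale (a : R) (w : pre_dform) : pre_dform :=
  fun x y => a * w x y.

Definition dform_of_bilinear (b : E -> E -> R) : pre_dform := fun x y =>
  match x, y with [:: u], [:: v] => b u v | _, _ => 0 end.

(* Value of a double form of bidegree (0, 0). *)
Definition dform_scalar (w : pre_dform) : R := w [::] [::].

Definition orthonormal_basis (b : E -> E -> R) (n : nat) (e : n.-tuple E) : Prop :=
  basis_of fullv e /\ forall i j : 'I_n, b (tnth e i) (tnth e j) = (i == j)%:R.

(* The operations below are relative to an orthonormal basis e; the results do not
   depend on it, not even on its orientation for the Hodge operator, which acts on
   both factors. *)
Section WithBasis.
Variables (n : nat) (e : n.-tuple E).

(* e_I for the increasing multi-index with underlying set I. *)
Definition basis_vectors (I : {set 'I_n}) : seq E := [seq tnth e i | i <- enum I].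

Definition volume_form (s : seq E) : R :=
  if size s == n then \det (\matrix_(i < n, j < n) coord e i s`_j) else 0.

(* ( * a)(x) = \sum_I a(e_I) vol(e_I, x) on forms, i.e. * e_I^* is the form with
   e_I^* /\ * e_I^* = vol, applied to both factors. *)
Definition hodge (w : pre_dform) : pre_dform := fun x y =>
  \sum_(I : {set 'I_n}) \sum_(J : {set 'I_n})
    w (basis_vectors I) (basis_vectors J)
    * volume_form (basis_vectors I ++ x) * volume_form (basis_vectors J ++ y).

Definition dform_contraction (w : pre_dform) : pre_dform := fun x y =>
  \sum_(i < n) w (tnth e i :: x) (tnth e i :: y).

Definition dform_inner (w t : pre_dform) : R :=
  \sum_(I : {set 'I_n}) \sum_(J : {set 'I_n})
    w (basis_vectors I) (basis_vectors J) * t (basis_vectors I) (basis_vectors J).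

(* N_{pk}(w) for w of bidegree (p, p), with g the metric as a (1, 1) form. *)
Definition newton (g w : pre_dform) (p k : nat) : pre_dform :=
  dform_scale ((n - p * k - p)`!%:R)^-1
    (hodge (dform_mul (dform_exp g (n - p * k - p)) (dform_exp w k))).

(* h_{2k}, for r the Riemann tensor as a (2, 2) form. *)
Definition gauss_bonnet (g r : pre_dform) (k : nat) : R :=
  dform_scalar (dform_scale ((n - 2 * k)`!%:R)^-1
    (hodge (dform_mul (dform_exp g (n - 2 * k)) (dform_exp r k)))).

End WithBasis.
End DoubleForms.

(* Smooth functions on an open subset of R^n. *)
Section Smooth.
Variables (R : realType) (n : nat).
Implicit Types (f : 'rV[R]_n -> R) (U : set 'rV[R]_n).

Definition partial (i : 'I_n) f : 'rV[R]_n -> R := 'D_(delta_mx 0 i) f.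

Definition iter_partial (s : seq 'I_n) f : 'rV[R]_n -> R := foldr partial f s.

Definition smooth_on U f : Prop := forall (s : seq 'I_n) u, U u ->
  {for u, continuous (iter_partial s f)} /\
  forall i, derivable (iter_partial s f) u (delta_mx 0 i).

End Smooth.

(* A chart is a homeomorphism chart_map, with inverse chart_inv, from an open set
   of M to an open subset of R^n; both are extended by junk values. *)
Record chart (R : realType) (M : topologicalType) (n : nat) := Chart {
  chart_dom : set M;
  chart_map : M -> 'rV[R]_n;
  chart_inv : 'rV[R]_n -> M;
  chart_dom_open : open chart_dom;
  chart_img_open : open (chart_map @` chart_dom);
  chart_mapK : {in chart_dom, cancel chart_map chart_inv};
  chart_map_continuous : {in chart_dom, continuous chart_map};
  chart_inv_continuous : {in chart_map @` chart_dom, continuous chart_inv}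
}.

(* A smooth n-manifold given by a smooth atlas, together with its tangent bundle:
   the tangent spaces are characterised by their coordinate bases
   (d/dx^1, ..., d/dx^n), one for each chart around the point, related by the
   Jacobian matrices of the changes of coordinates. *)
Record manifold (R : realType) (n : nat) := Manifold {
  carrier :> topologicalType;
  carrier_hausdorff : hausdorff_space carrier;
  carrier_second_countable : @second_countable carrier;
  atlas : set (chart R carrier n);
  atlas_cover : forall x, exists2 c, atlas c & chart_dom c x;
  atlas_smooth : forall c d, atlas c -> atlas d -> forall i : 'I_n,
    smooth_on (chart_map c @` (chart_dom c `&` chart_dom d))
              (fun u => chart_map d (chart_inv c u) 0 i);
  tangent : carrier -> vectType R;
  coord_field : chart R carrier n -> forall x, n.-tuple (tangent x);
  coord_field_basis : forall c x, atlas c -> chart_dom c x ->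
    basis_of fullv (coord_field c x);
  coord_field_change : forall c d x, atlas c -> atlas d ->
    chart_dom c x -> chart_dom d x -> forall j : 'I_n,
    tnth (coord_field c x) j =
      \sum_(i < n) partial j (fun u => chart_map d (chart_inv c u) 0 i)
                     (chart_map c x) *: tnth (coord_field d x) i
}.

Section RiemannianManifolds.
Variables (R : realType) (n : nat) (M : manifold R n).

Record riemannian_metric := RiemannianMetric {
  metric :> forall x : M, tangent x -> tangent x -> R;
  metric_linear : forall x a (u v w : tangent x),
    metric (a *: u + v) w = a * metric u w + metric v w;
  metric_symmetric : forall x (u v : tangent x), metric u v = metric v u;
  metric_pos : forall x (u : tangent x), u != 0 -> 0 < metric u u;
  metric_smooth : forall c, atlas c -> forall i j : 'I_n,
    smooth_on (chart_map c @` chart_dom c)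
      (fun u => metric (tnth (coord_field c (chart_inv c u)) i)
                       (tnth (coord_field c (chart_inv c u)) j))
}.

(* Smooth sections of Lambda^p T^*M (x) Lambda^q T^*M. *)
Record double_form (p q : nat) := DoubleForm {
  dform_at :> forall x : M, pre_dform (tangent x);
  dform_atP : forall x, is_dform p q (@dform_at x);
  dform_smooth : forall c, atlas c -> forall s t : seq 'I_n,
    smooth_on (chart_map c @` chart_dom c)
      (fun u => @dform_at (chart_inv c u)
                         [seq tnth (coord_field c (chart_inv c u)) i | i <- s]
                         [seq tnth (coord_field c (chart_inv c u)) i | i <- t])
}.

Arguments metric _ x _ _ : clear implicits.
Arguments dform_at {p q} _ x _ _.

Section Curvature.
Variables (g : riemannian_metric) (c : chart R M n).
Implicit Types u : 'rV[R]_n.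

Definition gram u : 'M[R]_n :=
  \matrix_(i, j) g (chart_inv c u) (tnth (coord_field c (chart_inv c u)) i)
                                   (tnth (coord_field c (chart_inv c u)) j).

(* Gamma^m_{ij} of the Levi-Civita connection. *)
Definition christoffel (m i j : 'I_n) u : R :=
  2^-1 * \sum_(a < n) invmx (gram u) m a *
    (partial i (fun v => gram v j a) u + partial j (fun v => gram v i a) u
     - partial a (fun v => gram v i j) u).

(* The component along d/dx^m of
   (nabla_i nabla_j - nabla_j nabla_i) (d/dx^l). *)
Definition curvature_up (m i j l : 'I_n) u : R :=
  partial i (christoffel m j l) u - partial j (christoffel m i l) u
  + \sum_(a < n) (christoffel m i a u * christoffel a j l u
                  - christoffel m j a u * christoffel a i l u).

(* R_{ijkl} = g(R(d_i, d_j) d_l, d_k): with this order of the last two indices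
   R(x, y; x, y) is the sectional curvature. *)
Definition curvature_down (i j k l : 'I_n) u : R :=
  \sum_(m < n) gram u k m * curvature_up m i j l u.

End Curvature.

(* r is the Riemann curvature tensor of g, regarded as a (2, 2) double form. *)
Definition is_riemann_tensor (g : riemannian_metric) (r : double_form 2 2) : Prop :=
  forall c x, atlas c -> chart_dom c x -> forall i j k l : 'I_n,
    let d := tnth (coord_field c x) in
    r x [:: d i; d j] [:: d k; d l] = curvature_down g c i j k l (chart_map c x).

Definition metric_dform (g : riemannian_metric) (x : M) : pre_dform (tangent x) :=
  dform_of_bilinear (g x).

End RiemannianManifolds.

Arguments metric {R n M} _ x _ _.
Arguments dform_at {R n M p q} _ x _ _.
Arguments metric_dform {R n M} g x _ _.

(* Main.v *)
Require Import Defs.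
From HB Require Import structures.
From mathcomp Require Import all_boot all_order all_algebra.
From mathcomp Require Import all_classical all_reals all_analysis.
(* Finite sets come last, to take precedence over classical sets. *)
From mathcomp Require Import fintype finset perm ring.

Set Implicit Arguments.
Unset Strict Implicit.
Unset Printing Implicit Defensive.

Import Order.TTheory GRing.Theory Num.Theory.
Import numFieldNormedType.Exports.

Local Open Scope ring_scope.

(** Everything takes place in one tangent space with an orthonormal basis e, and
    reduces to the coefficients w(e_I, e_J), for subsets I and J of the index set.

    The Hodge operator replaces the coefficient at (I, J) by the one at the
    complementary pair, up to the sign of the two shuffles (hodge_basis).  The
    exterior product of v and w has, at the top pair (T, T), exactly the same
    signed sum over pairs and their complements, so that
    < *v, w > = *(v w) (dform_inner_hodge).  For v = g^m w^k / m! this gives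
    <N(w), w> = *(g^m w^(k+1)) / m! by associativity alone (inner_newton), and
    this is h_(2k+2) when w is the Riemann tensor.

    It remains to see that *(g^m W) / m! = c^N W / N! for W = w^(k+1) and N = n - m.
    Since g^m / m! is the identity on m-vectors (metric_exp_basis), the left-hand
    side is the trace, the sum of W(e_I, e_I) over the subsets I of cardinality N
    (metric_exp_mul_top).  The iterated contraction sums W over all sequences of N
    indices; antisymmetry kills the repetitions and makes the N! orderings of
    each I contribute equally, the sign of an ordering being squared
    (iter_contraction).

    The algebra of the product (associativity, stability of antisymmetry) comes
    from a recursion that treats a sum over shuffles one vector at a time
    (shuffle_sum_cons).  Antisymmetry is used in the form of a sign change under the
    exchange of two neighbouring arguments. *)

(** * Signed sums over shuffles *)

Lemma shuffle_inversions_cons (b : bool) (m : bitseq) :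
  shuffle_inversions (b :: m) = (~~ b * count id m + shuffle_inversions m)%N.
Proof.
rewrite /shuffle_inversions [size _]/= big_ord_recl big_ord0 add0n.
under eq_bigr => i _ do rewrite big_ord_recl /=.
rewrite big_split /=; congr addn.
rewrite -sum1_count (big_nth false) big_mkord big_distrr /=.
by rewrite [RHS]big_mkcond; apply: eq_bigr => i _; case: nth; case: b.
Qed.

Section ShuffleSum.
Variables (T : Type) (R : comPzRingType).
Implicit Types (s t u v x y : seq T) (Phi Psi : seq T -> seq T -> R).

(** The sum over all ways to split x into two complementary subsequences, with the
    sign of the shuffle: the exterior product of f and h is the case
    Phi u v = f u * h v. *)
Definition shuffle_sum x Phi : R :=
  \sum_(m : (size x).-tuple bool)
    (-1) ^+ shuffle_inversions m * Phi (mask m x) (mask (map negb m) x).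

Lemma shuffle_sum_nil Phi : shuffle_sum [::] Phi = Phi [::] [::].
Proof.
rewrite /shuffle_sum (big_pred1 [tuple]) => [|m].
  by rewrite /shuffle_inversions big_ord0 mul1r.
by apply/esym/eqP; apply: tuple0.
Qed.

(** The head a of the sequence goes either to the left part, where it stays in
    front, or to the right one, where it has to jump over the whole left part. *)
Lemma shuffle_sum_cons a x Phi :
  shuffle_sum (a :: x) Phi =
    shuffle_sum x (fun u v => Phi (a :: u) v)
    + shuffle_sum x (fun u v => (-1) ^+ size u * Phi u (a :: v)).
Proof.
rewrite /shuffle_sum /= (reindex (fun p : bool * (size x).-tuple bool =>
  [tuple of p.1 :: p.2])) /=; last first.
  exists (fun m => (thead m, [tuple of behead m])) => [[b m] _|m _] /=.
    by congr pair; apply: val_inj.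
  by rewrite -tuple_eta.
rewrite -(pair_bigA _ (fun b (m : (size x).-tuple bool) =>
  (-1) ^+ shuffle_inversions (b :: m)
  * Phi (mask (b :: m) (a :: x)) (mask (map negb (b :: m)) (a :: x)))) big_bool /=.
congr (_ + _); apply: eq_bigr => m _; rewrite shuffle_inversions_cons //=.
by rewrite size_mask ?size_tuple // mul1n addnC exprD mulrA.
Qed.

Lemma eq_shuffle_sum x Phi Psi :
    (forall u v, size u + size v = size x -> Phi u v = Psi u v)%N ->
  shuffle_sum x Phi = shuffle_sum x Psi.
Proof.
move=> eqPhi; apply: eq_bigr => m _; rewrite eqPhi // !size_mask ?size_map ?size_tuple //.
by rewrite count_map (count_predC id) size_tuple.
Qed.

Lemma shuffle_sumD x Phi Psi :
  shuffle_sum x (fun u v => Phi u v + Psi u v) = shuffle_sum x Phi + shuffle_sum x Psi.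
Proof. by rewrite -big_split; apply: eq_bigr => m _; rewrite mulrDr. Qed.

Lemma shuffle_sumZ x c Phi :
  shuffle_sum x (fun u v => c * Phi u v) = c * shuffle_sum x Phi.
Proof. by rewrite mulr_sumr; apply: eq_bigr => m _; rewrite mulrCA. Qed.

Lemma shuffle_sumN x Phi : shuffle_sum x (fun u v => - Phi u v) = - shuffle_sum x Phi.
Proof. by rewrite -sumrN; apply: eq_bigr => m _; rewrite mulrN. Qed.

(** Both sides are the signed sum over the splittings of x into three parts; the
    recursion on x makes the comparison of signs automatic. *)
Lemma shuffle_sumA x (Theta : seq T -> seq T -> seq T -> R) :
  shuffle_sum x (fun u w => shuffle_sum u (fun v1 v2 => Theta v1 v2 w)) =
  shuffle_sum x (fun v1 u => shuffle_sum u (fun v2 w => Theta v1 v2 w)).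
Proof.
elim: x Theta => [|a x IHx] Theta; first by rewrite !shuffle_sum_nil.
rewrite !shuffle_sum_cons.
under [X in X + _ = _]eq_shuffle_sum do rewrite shuffle_sum_cons.
under [X in _ + X = _]eq_shuffle_sum do rewrite -shuffle_sumZ.
under [X in _ = _ + X]eq_shuffle_sum do rewrite shuffle_sum_cons mulrDr -!shuffle_sumZ.
rewrite !shuffle_sumD !IHx -addrA; congr (_ + (_ + _)).
rewrite -IHx; apply: eq_shuffle_sum => u v _.
by apply: eq_shuffle_sum => u1 u2 <-; rewrite exprD mulrA.
Qed.

Lemma shuffle_sum_nilr x Phi :
  (forall u v, ~~ nilp v -> Phi u v = 0) -> shuffle_sum x Phi = Phi x [::].
Proof.
elim: x Phi => [|a x IHx] Phi Phi0; first by rewrite shuffle_sum_nil.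
rewrite shuffle_sum_cons IHx => [|u v v0]; last by rewrite Phi0.
by rewrite IHx => [|u v _]; rewrite [Phi _ (_ :: _)]Phi0 ?mulr0 ?addr0.
Qed.

Lemma shuffle_sum_nill x Phi :
  (forall u v, ~~ nilp u -> Phi u v = 0) -> shuffle_sum x Phi = Phi [::] x.
Proof.
elim: x Phi => [|a x IHx] Phi Phi0; first by rewrite shuffle_sum_nil.
rewrite shuffle_sum_cons IHx => [|u v _]; last by rewrite Phi0.
by rewrite IHx => [|u v u0]; rewrite Phi0 ?mulr0 // add0r mul1r.
Qed.

End ShuffleSum.

Lemma exchange_shuffle_sum (R : comPzRingType) (T U : Type) (x : seq T) (y : seq U)
    (Theta : seq T -> seq T -> seq U -> seq U -> R) :
  shuffle_sum x (fun u u' => shuffle_sum y (fun v v' => Theta u u' v v')) =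
  shuffle_sum y (fun v v' => shuffle_sum x (fun u u' => Theta u u' v v')).
Proof.
rewrite /shuffle_sum; under eq_bigr do rewrite mulr_sumr.
rewrite exchange_big; apply: eq_bigr => m _.
by rewrite mulr_sumr; apply: eq_bigr => l _; rewrite mulrCA.
Qed.

(** * Antisymmetric functions of a sequence *)

Section Antisymmetry.
Variables (T : Type) (R : numDomainType).
Implicit Types (f : seq T -> R).

(** The part of the definition of an alternating form that exterior products
    visibly preserve, and that determines the effect of any permutation. *)
Definition swap_antisymmetric f : Prop :=
  forall s a b t, f (s ++ a :: b :: t) = - f (s ++ b :: a :: t).

Lemma swap_antisymmetric_move f s u a t : swap_antisymmetric f ->
  f (s ++ u ++ a :: t) = (-1) ^+ size u * f (s ++ a :: u ++ t).
Proof.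
move=> fN; elim: u s => [|b u IHu] s /=; first by rewrite mul1r.
by rewrite -cat_rcons IHu cat_rcons fN exprS mulN1r mulrN mulNr.
Qed.

(** Undoing a shuffle: the selected arguments move to the front, each over the
    unselected ones that precede it. *)
Lemma swap_antisymmetric_mask f (m : bitseq) s x :
    swap_antisymmetric f -> size m = size x ->
  f (s ++ mask m x ++ mask (map negb m) x) = (-1) ^+ shuffle_inversions m * f (s ++ x).
Proof.
move=> fN; elim: m x s => [|b m IHm] [|a x] s //=.
  by rewrite /shuffle_inversions big_ord0 mul1r.
case=> sz_m; rewrite shuffle_inversions_cons; case: b => /=.
  by rewrite -!cat_rcons IHm.
rewrite swap_antisymmetric_move // -!cat_rcons IHm // size_mask //.
by rewrite mul1n exprD mulrA.
Qed.

(** This is what makes exterior products of antisymmetric functions antisymmetric.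
    A general Phi lets the induction on s absorb the head of the sequence and the
    sign of its jump. *)
Lemma shuffle_sum_swap s a b t (Phi : seq T -> seq T -> R) :
    (forall v, swap_antisymmetric (Phi^~ v)) -> (forall u, swap_antisymmetric (Phi u)) ->
  shuffle_sum (s ++ a :: b :: t) Phi = - shuffle_sum (s ++ b :: a :: t) Phi.
Proof.
elim: s Phi => [|c s IHs] Phi PhiN1 PhiN2 /=.
  (* a and b go both left, both right, or to different sides; the two cases of the
     last kind are exchanged, and differ by one jump. *)
  have swap1 : shuffle_sum t (fun u v => Phi (a :: b :: u) v) =
               - shuffle_sum t (fun u v => Phi (b :: a :: u) v).
    by rewrite -shuffle_sumN; apply: eq_shuffle_sum => u v _; apply: (PhiN1 _ [::]).
  have swap2 :
      shuffle_sum t (fun u v =>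
        (-1) ^+ size u * ((-1) ^+ size u * Phi u (a :: b :: v))) =
      - shuffle_sum t (fun u v =>
        (-1) ^+ size u * ((-1) ^+ size u * Phi u (b :: a :: v))).
    rewrite -shuffle_sumN; apply: eq_shuffle_sum => u v _.
    by rewrite (PhiN2 _ [::]) !mulrN.
  have split_pair c d :
      shuffle_sum t (fun u v => (-1) ^+ size (c :: u) * Phi (c :: u) (d :: v)) =
      - shuffle_sum t (fun u v => (-1) ^+ size u * Phi (c :: u) (d :: v)).
    rewrite -shuffle_sumN; apply: eq_shuffle_sum => u v _.
    by rewrite exprS mulN1r mulNr.
  rewrite !shuffle_sum_cons swap1 swap2 !split_pair; ring.
rewrite !shuffle_sum_cons !IHs ?opprD // => v r1 c1 c2 r2.
- by rewrite !size_cat /= PhiN1 mulrN.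
- by rewrite (PhiN2 _ (c :: r1)) mulrN.
- exact: (PhiN1 v (c :: r1)).
Qed.

End Antisymmetry.

(** Two equal arguments can be made adjacent, and then f s = - f s. *)
Lemma swap_antisymmetric_nonuniq (T : eqType) (R : numDomainType) (f : seq T -> R) s :
  swap_antisymmetric f -> ~~ uniq s -> f s = 0.
Proof.
move=> fN; rewrite -[s in f s]cat0s; elim: s [::] => [|a s IHs] r //=.
rewrite negb_and negbK => /orP[/splitPr[u t]|]; last by rewrite -cat_rcons; apply: IHs.
rewrite -cat_rcons swap_antisymmetric_move // cat_rcons.
have /eqP := fN r a a (u ++ t); rewrite -addr_eq0 -mulr2n mulrn_eq0 /= => /eqP->.
by rewrite mulr0.
Qed.

(** * The algebra of double forms *)

Section DoubleFormAlgebra.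
Variables (R : realType) (E : vectType R).
Implicit Types (w t : pre_dform E) (x y : seq E).

Lemma dform_mulE w t x y :
  dform_mul w t x y =
  shuffle_sum x (fun u u' => shuffle_sum y (fun v v' => w u v * t u' v')).
Proof.
apply: eq_bigr => m _; rewrite mulr_sumr; apply: eq_bigr => l _.
by rewrite exprD !mulrA.
Qed.

(** The shuffles of x and those of y are independent, so associativity holds in
    each variable separately. *)
Lemma dform_mulA w1 w2 w3 :
  dform_mul w1 (dform_mul w2 w3) = dform_mul (dform_mul w1 w2) w3.
Proof.
apply/funext => x; apply/funext => y.
pose Theta a b c := fun a' b' c' => w1 a a' * (w2 b b' * w3 c c').
transitivity (shuffle_sum x (fun a d => shuffle_sum d (fun b c =>
  shuffle_sum y (fun a' d' => shuffle_sum d' (fun b' c' => Theta a b c a' b' c'))))).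
  rewrite dform_mulE; apply: eq_shuffle_sum => a d _.
  rewrite exchange_shuffle_sum; apply: eq_shuffle_sum => a' d' _.
  rewrite dform_mulE -shuffle_sumZ; apply: eq_shuffle_sum => b c _.
  by rewrite -shuffle_sumZ.
rewrite -shuffle_sumA dform_mulE; apply: eq_shuffle_sum => d c _.
under eq_shuffle_sum do rewrite -shuffle_sumA.
rewrite exchange_shuffle_sum; apply: eq_shuffle_sum => d' c' _.
rewrite dform_mulE [in RHS]mulrC -shuffle_sumZ; apply: eq_shuffle_sum => a b _.
by rewrite -shuffle_sumZ; apply: eq_shuffle_sum => a' b' _; rewrite /Theta mulrA mulrC.
Qed.

Lemma dform_mul1 w : dform_mul w (dform_one (R := R) (E := E)) = w.
Proof.
apply/funext => x; apply/funext => y.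
rewrite dform_mulE shuffle_sum_nilr => [|u u' /negPf u0].
  by rewrite shuffle_sum_nilr => [|v v' /negPf v0]; rewrite /dform_one /= ?v0 ?mulr0 ?mulr1.
by rewrite /shuffle_sum big1 // => m _; rewrite /dform_one u0 !mulr0.
Qed.

Lemma dform_1mul w : dform_mul (dform_one (R := R) (E := E)) w = w.
Proof.
apply/funext => x; apply/funext => y.
rewrite dform_mulE shuffle_sum_nill => [|u u' /negPf u0].
  by rewrite shuffle_sum_nill => [|v v' /negPf v0]; rewrite /dform_one /= ?v0 ?mul0r ?mul1r.
by rewrite /shuffle_sum big1 // => m _; rewrite /dform_one u0 mul0r mulr0.
Qed.

Lemma dform_expS w k : dform_exp w k.+1 = dform_mul w (dform_exp w k).
Proof. by []. Qed.

Lemma dform_expSr w k : dform_mul (dform_exp w k) w = dform_exp w k.+1.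
Proof.
elim: k => [|k IHk]; first by rewrite dform_1mul /dform_exp /= dform_mul1.
by rewrite dform_expS -dform_mulA IHk.
Qed.

Definition dform_antisymmetric w : Prop :=
  (forall y, swap_antisymmetric (w^~ y)) /\ (forall x, swap_antisymmetric (w x)).

(** Polarization: expand f at a repeated argument a + b. *)
Lemma alternating_swap p (f : seq E -> R) : alternating_form p f -> swap_antisymmetric f.
Proof.
case=> _ f_lin f_uniq s a b t.
have fD r c d q : f (r ++ (c + d) :: q) = f (r ++ c :: q) + f (r ++ d :: q).
  by rewrite -[c]scale1r f_lin scale1r mul1r.
have f0 c : f (s ++ c :: c :: t) = 0.
  by rewrite f_uniq // cat_uniq /= inE eqxx !andbF.
have fD2 c : f (s ++ c :: (a + b) :: t) = f (s ++ c :: a :: t) + f (s ++ c :: b :: t).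
  by have := fD (rcons s c) a b t; rewrite !cat_rcons.
have := f0 (a + b); rewrite fD !fD2 !f0 add0r addr0.
by move/eqP; rewrite addr_eq0 => /eqP.
Qed.

Lemma is_dform_antisymmetric p q w : is_dform p q w -> dform_antisymmetric w.
Proof. by case=> w1 w2; split=> z; apply: alternating_swap. Qed.

Lemma dform_mul_antisymmetric w t :
  dform_antisymmetric w -> dform_antisymmetric t -> dform_antisymmetric (dform_mul w t).
Proof.
move=> [w1 w2] [t1 t2]; split=> z s a b r; rewrite !dform_mulE.
  apply: shuffle_sum_swap => u r1 c d r2; rewrite -shuffle_sumN;
    apply: eq_shuffle_sum => v v' _.
    by rewrite w1 mulNr.
  by rewrite t1 mulrN.
rewrite -shuffle_sumN; apply: eq_shuffle_sum => u u' _.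
by apply: shuffle_sum_swap => v r1 c d r2; [rewrite w2 mulNr | rewrite t2 mulrN].
Qed.

Lemma dform_exp_antisymmetric w k :
  dform_antisymmetric w -> dform_antisymmetric (dform_exp w k).
Proof.
move=> wN; elim: k => [|k IHk]; last exact: dform_mul_antisymmetric.
split=> z s a b t; rewrite /dform_exp /= /dform_one;
  by case: s => [|? ?]; rewrite /= ?andbF oppr0.
Qed.

End DoubleFormAlgebra.

(** * Shuffles of an enumeration and subsets *)

Section SubsetShuffles.
Variables (I : finType).
Implicit Types (A B : {set I}).

Definition mask_of A B : bitseq := [seq i \in A | i <- enum B].

Lemma enum_subset A B : A \subset B -> enum A = mask (mask_of A B) (enum B).
Proof.
move=> sAB; rewrite -filter_mask /enum_mem -filter_predI; apply: eq_filter => i /=.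
by rewrite -!topredE /= andb_idr // => /(subsetP sAB).
Qed.

Lemma enum_setD A B : enum (B :\: A) = mask (map negb (mask_of A B)) (enum B).
Proof.
rewrite (enum_subset (subsetDl B A)) -map_comp -!filter_mask.
by apply: eq_in_filter => i; rewrite mem_enum inE => ->; rewrite andbT.
Qed.

(** The splittings of the enumeration of B are its subsets A, with complement
    B :\: A. *)
Lemma shuffle_sum_enum (R : comPzRingType) (T : Type) (f : I -> T) B
    (Phi : seq T -> seq T -> R) :
  shuffle_sum [seq f i | i <- enum B] Phi =
  \sum_(A : {set I} | A \subset B) (-1) ^+ shuffle_inversions (mask_of A B)
    * Phi [seq f i | i <- enum A] [seq f i | i <- enum (B :\: A)].
Proof.
pose n := size [seq f i | i <- enum B].
have size_m A : size (mask_of A B) == n by rewrite /n !size_map.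
pose set_of (m : n.-tuple bool) := [set i in mask m (enum B)].
have set_ofK m : true -> Tuple (size_m (set_of m)) = m.
  move=> _; apply: val_inj => /=; apply: (@eq_from_nth _ false).
    by rewrite size_tuple; apply/eqP.
  move=> k; rewrite size_map => k_lt.
  have i0 : I by case: (enum B) k_lt.
  rewrite (nth_map i0) //.
  by rewrite inE in_mask ?enum_uniq // mem_nth //= index_uniq ?enum_uniq.
rewrite /shuffle_sum (reindex_onto (fun A => Tuple (size_m A)) set_of set_ofK) /=.
apply: eq_big => [A|A sAB].
  apply/eqP/idP => [<-|sAB].
    by apply/subsetP=> i; rewrite inE => /mem_mask; rewrite mem_enum.
  by apply/setP=> i; rewrite inE -enum_subset ?mem_enum.
have {}sAB : A \subset B.
  move/eqP: sAB => <-; apply/subsetP=> i; rewrite inE => /mem_mask.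
  by rewrite mem_enum.
by rewrite -!map_mask -enum_setD -enum_subset.
Qed.

Lemma swap_antisymmetric_enum (R : numDomainType) (T : Type) (f : I -> T) A B
    (h : seq T -> R) : swap_antisymmetric h -> A \subset B ->
  h ([seq f i | i <- enum A] ++ [seq f i | i <- enum (B :\: A)]) =
  (-1) ^+ shuffle_inversions (mask_of A B) * h [seq f i | i <- enum B].
Proof.
move=> hN sAB; rewrite (enum_subset sAB) enum_setD !map_mask.
by rewrite (swap_antisymmetric_mask [::] hN) // !size_map.
Qed.

End SubsetShuffles.

(** * Coefficients in an orthonormal basis *)

Section Bases.
Variables (R : realType) (E : vectType R) (n : nat) (e : n.-tuple E).
Implicit Types (w v : pre_dform E) (A B I J : {set 'I_n}).

Local Notation e_ := (basis_vectors e).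

Lemma size_basis_vectors A : size (e_ A) = #|A|.
Proof. by rewrite size_map cardE. Qed.

Definition shuffle_sign A B : R := (-1) ^+ shuffle_inversions (mask_of A B).

Lemma shuffle_sign_sqr A B : shuffle_sign A B * shuffle_sign A B = 1.
Proof. by rewrite -expr2 sqrr_sign. Qed.

(** Exchanging two arguments exchanges two columns of the determinant. *)
Lemma volume_form_swap : swap_antisymmetric (volume_form e).
Proof.
move=> s a b t; rewrite /volume_form !size_cat /=.
case: eqP => [sz_n|_]; last by rewrite oppr0.
have lt0 : (size s < n)%N by rewrite -sz_n addnS ltnS leq_addr.
have lt1 : ((size s).+1 < n)%N by rewrite -sz_n !addnS !ltnS leq_addr.
pose i0 := Ordinal lt0; pose i1 := Ordinal lt1.
have -> : \matrix_(i < n, j < n) coord e i (s ++ a :: b :: t)`_j =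
    col_perm (tperm i0 i1) (\matrix_(i < n, j < n) coord e i (s ++ b :: a :: t)`_j).
  apply/matrixP=> i j; rewrite !mxE; congr (coord e i _).
  case: tpermP => [->|->|/eqP j0 /eqP j1] /=; rewrite !nth_cat ?ltnn ?subnn //.
  - by rewrite ltnNge leqnSn /= subSnn.
  - by rewrite ltnNge leqnSn /= subSnn.
  case: ltnP => // le_sj; rewrite -!val_eqE /= in j0 j1.
  rewrite -(subnKC le_sj) in j0 j1 *; rewrite addKn.
  move: (j - size s)%N j0 j1 => [|[|k]] //; first by rewrite addn0 eqxx.
  by rewrite addn1 eqxx.
rewrite col_permE det_mulmx det_perm odd_permV odd_tperm.
by rewrite -val_eqE /= neq_ltn ltnSn mulrN1.
Qed.

Hypothesis e_basis : basis_of fullv e.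

Lemma volume_form_basis : volume_form e (e_ setT) = 1.
Proof.
rewrite /volume_form size_basis_vectors cardsT card_ord eqxx -[RHS](det1 _ n).
congr (\det _); apply/matrixP=> i j; rewrite !mxE.
rewrite (nth_map j) ?enum_setT -?enumT ?size_enum_ord // nth_ord_enum (tnth_nth 0).
by rewrite (coord_free _ _ (basis_free e_basis)) eq_sym.
Qed.

(** Unless A and B are complementary, e_A followed by e_B has the wrong length or
    a repeated vector. *)
Lemma volume_form_split A B :
  volume_form e (e_ A ++ e_ B) = if A == ~: B then shuffle_sign A setT else 0.
Proof.
case: eqP => [->|/eqP neqAB].
  have := swap_antisymmetric_enum (tnth e) volume_form_swap (subsetT (~: B)).
  by rewrite !setTD setCK volume_form_basis mulr1.
rewrite {1}/volume_form size_cat !size_basis_vectors.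
case: eqP => // cardAB; have [dAB|] := boolP [disjoint A & B].
  case/negP: neqAB; rewrite eqEcard -disjoints_subset dAB /=.
  by rewrite -(leq_add2r #|B|) cardAB addnC cardsC card_ord.
rewrite disjoint_sym => /pred0Pn[i /andP[/= iB iA]].
have := swap_antisymmetric_nonuniq (s := e_ A ++ e_ B) volume_form_swap.
rewrite {1}/volume_form size_cat !size_basis_vectors cardAB eqxx; apply.
rewrite cat_uniq negb_and; apply/orP; right; rewrite negb_and; apply/orP; left.
by rewrite negbK; apply/hasP; exists (tnth e i); apply: map_f; rewrite mem_enum.
Qed.

Lemma hodge_basis v I J :
  hodge e v (e_ I) (e_ J) =
  shuffle_sign (~: I) setT * shuffle_sign (~: J) setT * v (e_ (~: I)) (e_ (~: J)).
Proof.
rewrite /hodge (bigD1 (~: I)) //= (bigD1 (~: J)) //= !volume_form_split !eqxx.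
rewrite [X in _ + X + _]big1 => [|B neqB]; last first.
  by rewrite !volume_form_split (negPf neqB) mulr0.
rewrite big1 => [|A neqA]; last first.
  by rewrite big1 // => B _; rewrite !volume_form_split (negPf neqA) mulr0 mul0r.
by rewrite !addr0 -mulrA mulrC.
Qed.

Lemma dform_mul_basis w v I J :
  dform_mul w v (e_ I) (e_ J) =
  \sum_(A : {set 'I_n} | A \subset I) \sum_(B : {set 'I_n} | B \subset J)
    shuffle_sign A I * shuffle_sign B J
    * (w (e_ A) (e_ B) * v (e_ (I :\: A)) (e_ (J :\: B))).
Proof.
rewrite dform_mulE shuffle_sum_enum; apply: eq_bigr => A _.
by rewrite shuffle_sum_enum mulr_sumr; apply: eq_bigr => B _; rewrite mulrA.
Qed.

Lemma dform_scalar_hodge v : dform_scalar (hodge e v) = v (e_ setT) (e_ setT).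
Proof.
have e0 : [::] = e_ set0 by rewrite /basis_vectors enum_set0.
by rewrite /dform_scalar [in LHS]e0 hodge_basis setC0 shuffle_sign_sqr mul1r.
Qed.

(** < *v, w > and the top coefficient of v w pair each coefficient of w with
    the complementary coefficient of v, with the same sign. *)
Lemma dform_inner_hodge v w :
  dform_inner e (hodge e v) w = dform_scalar (hodge e (dform_mul v w)).
Proof.
rewrite dform_scalar_hodge dform_mul_basis /dform_inner (reindex_inj (@setC_inj _)).
rewrite [RHS](eq_bigl xpredT) => [|A]; last exact: subsetT.
apply: eq_bigr => A _.
rewrite (reindex_inj (@setC_inj _)) [RHS](eq_bigl xpredT) => [|B]; last exact: subsetT.
by apply: eq_bigr => B _; rewrite hodge_basis !setCK !setTD mulrA.
Qed.

(** Associativity moves the last factor w inside the power.  For p = 2 the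
    right-hand side is the Gauss-Bonnet curvature h_(2k+2). *)
Lemma inner_newton (g : pre_dform E) w p k :
  dform_inner e (newton e g w p k) w =
  dform_scalar (dform_scale ((n - p * k - p)`!%:R)^-1
    (hodge e (dform_mul (dform_exp g (n - p * k - p)) (dform_exp w k.+1)))).
Proof.
rewrite -dform_expSr dform_mulA /dform_scalar /dform_scale.
rewrite -[hodge e _ _ _]/(dform_scalar _) -dform_inner_hodge /dform_inner mulr_sumr.
by apply: eq_bigr => A _; rewrite mulr_sumr; apply: eq_bigr => B _; rewrite mulrA.
Qed.

(** Moving e_i to its place in e_J costs the same sign in both variables. *)
Lemma contraction_insert w (i : 'I_n) J : dform_antisymmetric w -> i \in J ->
  w (tnth e i :: e_ (J :\ i)) (tnth e i :: e_ (J :\ i)) = w (e_ J) (e_ J).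
Proof.
move=> [w1 w2] iJ; have sJ : [set i] \subset J by rewrite sub1set.
have -> : tnth e i :: e_ (J :\ i) = e_ [set i] ++ e_ (J :\ i).
  by rewrite /basis_vectors enum_set1.
rewrite (swap_antisymmetric_enum (tnth e) (w1 _) sJ).
rewrite (swap_antisymmetric_enum (tnth e) (w2 _) sJ).
by rewrite mulrA -expr2 sqrr_sign mul1r.
Qed.

(** In the sum over pairs of an index i and a set I, the terms with i in I vanish;
    the others are indexed by J = I + i and a choice of i in J, which
    leaves N + 1 equal terms for each J. *)
Lemma sum_contraction w N : dform_antisymmetric w ->
  \sum_(I : {set 'I_n} | #|I| == N) dform_contraction e w (e_ I) (e_ I) =
  N.+1%:R * \sum_(J : {set 'I_n} | #|J| == N.+1) w (e_ J) (e_ J).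
Proof.
move=> wN; rewrite /dform_contraction exchange_big /=.
transitivity (\sum_(i < n)
    \sum_(J : {set 'I_n} | (i \in J) && (#|J| == N.+1)) w (e_ J) (e_ J)).
  apply: eq_bigr => i _; rewrite (bigID [pred I : {set 'I_n} | i \in I]) /= big1 => [|I].
    rewrite add0r (reindex_onto (fun J => J :\ i) (fun I => i |: I)) => [|I /andP[_ iI]] /=.
      apply: eq_big => [J|J /andP[_ /eqP eJ]].
        rewrite setD11 andbT; have [iJ|niJ] := boolP (i \in J).
          by rewrite setD1K // eqxx andbT (cardsD1 i J) iJ.
        by apply/negP => /andP[_ /eqP eJ]; rewrite -eJ setU11 in niJ.
      by apply: contraction_insert => //; rewrite -eJ setU11.
    by rewrite setU1K.
  case/andP=> _ iI; apply: swap_antisymmetric_nonuniq (wN.1 _) _.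
  by rewrite /= map_f // mem_enum.
rewrite (exchange_big_dep (fun J : {set 'I_n} => #|J| == N.+1)) /= => [|i J _ /andP[] //].
rewrite mulr_sumr; apply: eq_bigr => J /eqP cJ.
rewrite (eq_bigl [in J]) => [|i]; last by rewrite cJ eqxx andbT.
by rewrite sumr_const cJ mulr_natl.
Qed.

Lemma dform_contraction_antisymmetric w :
  dform_antisymmetric w -> dform_antisymmetric (dform_contraction e w).
Proof.
move=> [w1 w2]; split=> z s a b t; rewrite /dform_contraction -sumrN; apply: eq_bigr => i _.
  exact: (w1 _ (_ :: s)).
exact: (w2 _ (_ :: s)).
Qed.

Lemma iter_contraction w N : dform_antisymmetric w ->
  dform_scalar (iter N (dform_contraction e) w) =
  N`!%:R * \sum_(I : {set 'I_n} | #|I| == N) w (e_ I) (e_ I).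
Proof.
elim: N w => [|N IHN] w wN.
  rewrite (big_pred1 set0) => [|A]; last by rewrite cards_eq0.
  by rewrite mul1r /basis_vectors enum_set0.
rewrite iterSr IHN; last exact: dform_contraction_antisymmetric.
by rewrite sum_contraction // mulrA -natrM mulnC -factS.
Qed.

Section Metric.
Variable b : E -> E -> R.
Hypothesis b_orthonormal : forall i j : 'I_n, b (tnth e i) (tnth e j) = (i == j)%:R.

Let g := dform_of_bilinear b.

Lemma metric_basis A B : g (e_ A) (e_ B) = ((A == B) && (#|A| == 1%N))%:R.
Proof.
have [/cards1P[i ->]|neqA] := boolP (#|A| == 1%N); last first.
  rewrite andbF /g /dform_of_bilinear; move: neqA; rewrite -size_basis_vectors.
  by case: (e_ A) => [|? [|? ?]].
have [/cards1P[j ->]|neqB] := boolP (#|B| == 1%N).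
  by rewrite andbT (inj_eq set1_inj) /basis_vectors !enum_set1 /= b_orthonormal.
have [eqB|_] := eqVneq; first by rewrite -eqB cards1 in neqB.
rewrite /g /dform_of_bilinear; move: neqB; rewrite -size_basis_vectors.
by rewrite [e_ [set i]]/basis_vectors enum_set1 /=; case: (e_ B) => [|? [|? ?]].
Qed.

(** g^m / m! is the identity of the space of m-vectors.  In the induction, the
    product with g removes one common index from I and J, in m + 1 ways. *)
Lemma metric_exp_basis m I J :
  dform_exp g m (e_ I) (e_ J) = m`!%:R * ((I == J) && (#|I| == m))%:R.
Proof.
elim: m I J => [|m IHm] I J.
  rewrite /dform_exp /= /dform_one /nilp !size_basis_vectors mul1r; congr _%:R.
  congr nat_of_bool; rewrite !cards_eq0; have [->|] := eqVneq I set0; last by rewrite andbF.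
  by rewrite andbT eq_sym.
rewrite dform_expS dform_mul_basis.
transitivity (\sum_(A : {set 'I_n} | A \subset I)
    (#|A| == 1%N)%:R * (m`!%:R * ((I == J) && (#|I| == m.+1))%:R) : R).
  apply: eq_bigr => A sAI; under eq_bigr do rewrite metric_basis IHm.
  have [cA|_] := eqVneq #|A| 1%N; last first.
    by rewrite big1 ?mul0r // => B _; rewrite andbF mul0r mulr0.
  have [<-|neqIJ] := eqVneq I J; last first.
    rewrite !mulr0 big1 // => B sBJ.
    have [eqAB|] := eqVneq A B; last by rewrite mul0r mulr0.
    rewrite -{}eqAB in sBJ *; have [eqD|] := eqVneq; last by rewrite !mulr0.
    case/eqP: neqIJ; rewrite -(setID I A) -(setID J A) eqD.
    by rewrite (setIidPr sAI) (setIidPr sBJ).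
  rewrite (bigD1 A) //= big1 => [|B /andP[_ neqBA]]; last first.
    by rewrite eq_sym (negPf neqBA) mul0r mulr0.
  rewrite !eqxx shuffle_sign_sqr addr0 !mul1r cardsD (setIidPr sAI) cA.
  by have := subset_leq_card sAI; rewrite cA; case: #|I| => // k; rewrite subn1.
rewrite -mulr_suml -natr_sum -big_mkcondr sum1dep_card cards_draws bin1 factS natrM.
by case: (_ =P m.+1) => [->|_]; rewrite ?andbF ?mulr0 // mulrA.
Qed.

(** Only equal pairs (A, A) contribute to the product with g^m at the top, with
    sign 1: this is the full trace of the part of w of complementary degree. *)
Lemma metric_exp_mul_top m w : (m <= n)%N ->
  dform_mul (dform_exp g m) w (e_ setT) (e_ setT) =
  m`!%:R * \sum_(I : {set 'I_n} | #|I| == (n - m)%N) w (e_ I) (e_ I).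
Proof.
move=> le_mn; rewrite dform_mul_basis (reindex_inj (@setC_inj _)) /= mulr_sumr.
rewrite [RHS]big_mkcond.
rewrite [LHS](eq_bigl xpredT) => [|A]; last exact: subsetT.
apply: eq_bigr => A _; rewrite (bigD1 (~: A)) ?subsetT //= big1 => [|B /andP[_ neqB]].
  rewrite shuffle_sign_sqr metric_exp_basis eqxx !setTD setCK addr0 mul1r.
  have -> : (#|~: A| == m) = (#|A| == (n - m)%N).
    have cA : (#|A| + #|~: A| = n)%N by rewrite cardsC card_ord.
    apply/eqP/eqP => eq_m; apply/eqP.
      by rewrite -(eqn_add2r #|~: A|) cA eq_m subnK.
    by rewrite -(eqn_add2l #|A|) cA eq_m subnK.
  by case: ifP => _; rewrite ?mulr1 // mulr0 mul0r.
by rewrite metric_exp_basis eq_sym (negPf neqB) mulr0 mul0r mulr0.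
Qed.

End Metric.

End Bases.

Theorem theoremA3 (R : realType) (n : nat) (M : manifold R n)
    (g : riemannian_metric M) :
  (forall (p k : nat) (w : double_form M p p), (p * k + p <= n)%N ->
     forall (x : M) (e : n.-tuple (tangent x)), orthonormal_basis (g x) e ->
       dform_inner e (newton e (metric_dform g x) (w x) p k) (w x) =
       dform_scalar (iter (p * k + p) (dform_contraction e) (dform_exp (w x) k.+1))
         / (p * k + p)`!%:R)
  /\
  (forall (r : double_form M 2 2), is_riemann_tensor g r ->
     forall k : nat, (2 * k + 2 <= n)%N ->
     forall (x : M) (e : n.-tuple (tangent x)), orthonormal_basis (g x) e ->
       gauss_bonnet e (metric_dform g x) (r x) k.+1 =
       dform_inner e (newton e (metric_dform g x) (r x) 2 k) (r x)).
Proof.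
split=> [p k w le_n x e [e_basis e_orth]|r _ k le_n x e [e_basis _]].
  have fact_neq0 m : m`!%:R != 0 :> R by rewrite pnatr_eq0 -lt0n fact_gt0.
  rewrite (inner_newton e_basis) /dform_scalar /dform_scale.
  rewrite -[hodge _ _ _ _]/(dform_scalar _) (dform_scalar_hodge e_basis).
  rewrite (metric_exp_mul_top e_orth) ?mulKf //; last by rewrite -subnDA leq_subr.
  (* Both members are now traces, over the subsets of cardinality pk + p. *)
  have wN := dform_exp_antisymmetric k.+1 (is_dform_antisymmetric (dform_atP w x)).
  rewrite -[iter _ _ _ _ _]/(dform_scalar _) (iter_contraction _ _ wN).
  by rewrite mulrAC mulfV // mul1r -subnDA subKn.
by rewrite (inner_newton e_basis) /gauss_bonnet mulnSr subnDA.
Qed.
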